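(* Consider a generalized modified splitting method $\Phi_h=e^{b_shB_s}e^{a_shA}\cdots e^{b_1hB_1}e^{a_1hA}$ of order $p$, with $a_j,b_j\in\mathbb R$, $\sum_{j=1}^sa_j=1$, and $B_j=\frac1hB(\beta_j)$, where each $\beta_j$ is an infinitesimal character with $\beta_j((0))=1$. Choose $\hat j\in\{1,\dots,s\}$ such that $\beta_{\hat j}(\mu)=0$ for all $\mu\in\mathbb N^\infty$ with $|\mu|=p+1$, and such that $\alpha((0),\hat j)=b_{\hat j}\neq0$. Define $$\tilde\beta_{\hat j}(\mu):=\beta_{\hat j}(\mu)\ \text{ for }|\mu|\le p,\qquad \tilde\beta_{\hat j}(\mu):=\frac1{\alpha((0),\hat j)}\Big(\frac1{\gamma(\mu)}-(\beta\star\alpha)(\mu)\Big)\ \text{ for }|\mu|=p+1,$$ (with values for $|\mu|>p+1$ arbitrary subject to $\tilde\beta_{\hat j}$ being an infinitesimal character). Then replacing $\beta_{\hat j}$ by $\tilde\beta_{\hat j}$ in the method (i.e. $B_{\hat j}$ by $\frac1hB(\tilde\beta_{\hat j})$) yields a new generalized modified splitting method of order $p+1$.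
   Context: $\mathbb N$ contains $0$. $A,B$ are linear operators; operator exponentials and infinite sums are read as formal power series in the time step $h$. $[X,Y]=XY-YX$; $\mathrm{ad}_X^0(Y)=Y$, $\mathrm{ad}_X^j(Y)=[X,\mathrm{ad}_X^{j-1}(Y)]$. Multi-indices: finite tuples $\mu=(\mu_1,\dots,\mu_k)\in\mathbb N^k$, $k\ge0$ (empty one: $\mathbf 1$); the set of all is $\mathbb N^\infty$, spanning the real vector space $\mathcal M$; $\#\mu=k$, $\mu!=\prod_j\mu_j!$, $|\mu|=k+\sum_j\mu_j$. $\mathbb F(\mu)=h^{|\mu|}\mathrm{ad}_{-A}^{\mu_k}(B)\cdots\mathrm{ad}_{-A}^{\mu_1}(B)$, $\mathbb F(\mathbf 1)=\mathrm{id}$; multi-index series $B(\alpha)=\sum_{\mu\in\mathbb N^\infty}\frac{\alpha(\mu)}{\mu!}\mathbb F(\mu)$. An infinitesimal character is a map $\beta:\mathbb N^\infty\to\mathbb R$ (extended linearly) with $\beta(\mathbf 1)=0$ and $\beta(\mu\sqcup\!\sqcup\eta)=0$ for all non-empty $\mu,\eta$, $\sqcup\!\sqcup$ being the shuffle product of tuples regarded as words. In a generalized modified splitting method, each $B_j=\frac1hB(\beta_j)$ with $\beta_j$ an infinitesimal character, $\beta_j((0))=1$; equivalently $B_j$ is $B$ plus a formal linear combination of nested commutators of $A$ and $B$, a commutator with $m$ letters multiplied by $h^{m-1}$. $\gamma(\mu)=\prod_{l=1}^k|(\mu_1,\dots,\mu_l)|$ for $\mu\in\mathbb N^k$; the exact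 flow is $e^{h(A+B)}=e^{hA}B(1/\gamma)$. $\Lambda_k=\{\lambda\in\mathbb N^k:1\le\lambda_1\le\cdots\le\lambda_k\le s\}$, $\alpha(\mu,\lambda)=\prod_{i=1}^kb_{\lambda_i}c_{\lambda_i}^{\mu_i}$ with $c_m=\sum_{j=1}^ma_j$ (convention $0^0=1$). The method expands as $\Phi_h=e^{hA}B(\beta\star\alpha)$, where $$(\beta\star\alpha)(\mu)=\sum_{(\mu)}\ \sum_{\lambda\in\Lambda_{\#\mu_{(2)}}}\frac1{q_1!\cdots q_s!}\,\beta_\lambda(\mu_{(1)})\,\alpha(\mu_{(2)},\lambda),$$ $q_i$ being the number of occurrences of $i$ in $\lambda$, $\beta_\lambda(\eta_1\odot\cdots\odot\eta_k)=\prod_i\beta_{\lambda_i}(\eta_i)$, and $\sum_{(\mu)}\mu_{(1)}\otimes\mu_{(2)}=\Delta_\triangleright(\mu)$ with $$\Delta_\triangleright(\mu)=\sum_{\pi\in P(\mu),\ p_i\in\mathbb N^{\#\pi_i}}\binom{\pi_1}{p_1}\cdots\binom{\pi_k}{p_k}(\pi_1\setminus p_1)\odot\cdots\odot(\pi_k\setminus p_k)\otimes\Big(\sum_jp_{1,j},\dots,\sum_jp_{k,j}\Big)\in T(\mathcal M)\otimes\mathcal M.$$ Here $T(\mathcal M)$ is the tensor algebra with product $\odot$ and unit $\mathbf 1_T$; $P(\mu)$ is the set of all $(\pi_1,\dots,\pi_k)$ (varying $k$) of non-empty multi-indices whose concatenation is $\mu$; $\Delta_\triangleright(\mathbf 1)=\mathbf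 1_T\otimes\mathbf 1$; $\binom{\pi}{p}=\prod_i\binom{\pi_i}{p_i}$; $\pi\setminus p$ is the entrywise difference if all its entries are $\ge0$ and $0\in\mathcal M$ otherwise. The method is of order $p$ if $(\beta\star\alpha)(\mu)=1/\gamma(\mu)$ for all $\mu\in\mathbb N^\infty$ with $|\mu|\le p$. *)

(* Defs.v *)
From mathcomp Require Import all_boot all_order all_algebra.
From mathcomp Require Import finmap monalg reals.

Set Implicit Arguments.
Unset Strict Implicit.
Unset Printing Implicit Defensive.

Import Order.TTheory GRing.Theory Num.Theory.

Local Open Scope ring_scope.

(* |mu| *)
Definition weight (mu : seq nat) : nat := (size mu + sumn mu)%N.

(* gamma(mu) = \prod_(1 <= l <= k) |(mu_1, ..., mu_l)| *)
Definition gamma (mu : seq nat) : nat :=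
  (\prod_(1 <= l < (size mu).+1) weight (take l mu))%N.

(* The real vector space with basis K is {malg R[K]}, where << k >> is the basis
   vector k.  [lext f] is the linear extension of f : K -> R. *)
Definition lext (R : realType) (K : choiceType) (f : K -> R)
    (x : {malg R[K]}) : R :=
  \sum_(k <- msupp x) x@_k * f k.

(* The list, with multiplicities, of the words occurring in the shuffle product
   of u and v:  au' ⧢ bv' = a(u' ⧢ bv') + b(au' ⧢ v'). *)
Fixpoint shuffle_words (T : Type) (u : seq T) : seq T -> seq (seq T) :=
  match u with
  | [::] => fun v => [:: v]
  | a :: u' =>
      fix shuffle_u (v : seq T) : seq (seq T) :=
        match v with
        | [::] => [:: u]
        | b :: v' => map (cons a) (shuffle_words u' v)
                     ++ map (cons b) (shuffle_u v')
        end
  end.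

Definition shuffle (R : realType) (mu eta : seq nat) : {malg R[seq nat]} :=
  \sum_(w <- shuffle_words mu eta) << w >>.

Definition inf_character (R : realType) (beta : seq nat -> R) : Prop :=
  beta [::] = 0 /\
  forall mu eta : seq nat, mu != [::] -> eta != [::] ->
    lext beta (shuffle R mu eta) = 0.

(* P(mu); see [mem_splits] and [splits_uniq]. *)
Fixpoint splits (mu : seq nat) : seq (seq (seq nat)) :=
  match mu with
  | [::] => [:: [::]]
  | m :: mu' =>
      map (cons [:: m]) (splits mu')
      ++ pmap (fun P => if P is q :: P' then Some ((m :: q) :: P') else None)
              (splits mu')
  end.

Lemma mem_splits (mu : seq nat) (P : seq (seq nat)) :
  (P \in splits mu) = ([::] \notin P) && (flatten P == mu).
Proof.
elim: mu P => [|m mu IH] P /=.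
  by rewrite inE; case: P => [|[|x q] P] //=; rewrite andbF.
rewrite mem_cat; apply/idP/idP.
  case/orP.
    case/mapP => Q; rewrite IH => /andP[HQ /eqP <-] -> /=.
    by rewrite inE /= HQ eqxx.
  rewrite mem_pmap => /mapP[[|q Q] //]; rewrite IH inE negb_or /=.
  by move=> /andP[/andP[_ HQ] /eqP <-] [->]; rewrite inE /= HQ eqxx.
case: P => [|[|x [|y q]] P] //=; rewrite ?inE //= => /andP[HP /eqP[-> E]].
  by apply/orP; left; apply: map_f; rewrite IH HP E eqxx.
apply/orP; right; rewrite mem_pmap; apply/mapP; exists ((y :: q) :: P) => //.
by rewrite IH inE /= HP E eqxx.
Qed.

Lemma splits_uniq (mu : seq nat) : uniq (splits mu).
Proof.
elim: mu => [|m mu IH] //=; rewrite cat_uniq map_inj_uniq ?IH /=; last first.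
  by move=> x y [].
apply/andP; split.
  apply/hasPn => P; rewrite mem_pmap => /mapP[[|q Q] //].
  rewrite mem_splits inE negb_or => /andP[/andP[q0 _] _] [->].
  by apply/mapP => -[Q' _ [E _]]; rewrite E in q0.
rewrite -(map_inj_uniq (@Some_inj _)) pmapS_filter.
rewrite map_inj_in_uniq ?filter_uniq // => -[|p P] [|q Q];
  rewrite !mem_filter //= => _ _ [-> ->] //.
Qed.

(* All sequences x with size x = size ss and x_i in ss_i for every i. *)
Definition cartprod (T : Type) (ss : seq (seq T)) : seq (seq T) :=
  foldr (fun s acc => [seq x :: y | x <- s, y <- acc]) [:: [::]] ss.

(* The p in N^(#pi) with p <= pi entrywise: the only ones for which
   pi \ p is not the zero vector. *)
Definition below (pi : seq nat) : seq (seq nat) :=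
  cartprod [seq iota 0 m.+1 | m <- pi].

Definition mbinom (pi p : seq nat) : nat :=
  (\prod_(x <- zip pi p) 'C(x.1, x.2))%N.

Definition mdiff (pi p : seq nat) : seq nat := [seq (x.1 - x.2)%N | x <- zip pi p].

(* T(M) has as basis the words of multi-indices (the word [::] is the unit
   1_T, whereas [:: [::]] is the empty multi-index seen as a letter), so
   T(M) (x) M has as basis the pairs of such a word and a multi-index. *)
Definition coproduct (R : realType) (mu : seq nat) :
    {malg R[(seq (seq nat) * seq nat)%type]} :=
  \sum_(pi <- splits mu) \sum_(p <- cartprod (map below pi))
    (\prod_(x <- zip pi p) mbinom x.1 x.2)%N%:R *:
      << ([seq mdiff x.1 x.2 | x <- zip pi p], map sumn p) >>.

Section Method.
Variables (R : realType) (s : nat) (a b : 'I_s -> R).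
Variable beta : 'I_s -> seq nat -> R.

(* Stages are numbered from 0, so c_m = a_0 + ... + a_m. *)
Definition abscissa (m : 'I_s) : R := \sum_(j < s | (j <= m)%N) a j.

Definition alpha (mu : seq nat) (lam : seq 'I_s) : R :=
  \prod_(x <- zip mu lam) (b x.2 * abscissa x.2 ^+ x.1).

(* beta_lambda on the basis element eta_1 (.) ... (.) eta_k of T(M) *)
Definition beta_word (lam : seq 'I_s) (w : seq (seq nat)) : R :=
  \prod_(x <- zip lam w) beta x.1 x.2.

(* q_1! ... q_s! *)
Definition mult_fact (lam : seq 'I_s) : nat :=
  (\prod_(i < s) (count_mem i lam)`!)%N.

(* The nondecreasing tuples form Lambda_k. *)
Definition star (mu : seq nat) : R :=
  lext (fun wn : seq (seq nat) * seq nat =>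
          \sum_(lam : (size wn.2).-tuple 'I_s
                | sorted (fun i j : 'I_s => (i <= j)%N) lam)
             (mult_fact lam)%:R^-1 * beta_word lam wn.1 * alpha wn.2 lam)
       (coproduct R mu).

(* The method e^(b_s h B_s) e^(a_s h A) ... e^(b_1 h B_1) e^(a_1 h A) with
   B_j = B(beta_j) / h is given by its coefficients (a, b, beta). *)
Definition gen_mod_splitting : Prop :=
  \sum_(j < s) a j = 1 /\
  forall j : 'I_s, inf_character (beta j) /\ beta j [:: 0%N] = 1.

Definition has_order (p : nat) : Prop :=
  forall mu : seq nat, (weight mu <= p)%N -> star mu = (gamma mu)%:R^-1.

(* The requirements on the values of the new beta_j in weights <= p + 1 *)
Definition is_correction (p : nat) (j : 'I_s) (bt : seq nat -> R) : Prop :=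
  (forall mu : seq nat, (weight mu <= p)%N -> bt mu = beta j mu) /\
  (forall mu : seq nat, weight mu = p.+1 ->
     bt mu = (alpha [:: 0%N] [:: j])^-1 * ((gamma mu)%:R^-1 - star mu)).

Definition replace_beta (j : 'I_s) (bt : seq nat -> R) : 'I_s -> seq nat -> R :=
  fun i => if i == j then bt else beta i.

End Method.

(* Main.v *)
(* Conjugating the factor e^(b_l h B_l) by e^(c_l h A) turns beta_l into
   kappa_l = b_l (beta_l o T), where T substitutes \sum_q 'C(m, q) c_l^q (m - q)
   for each letter m; as T commutes with shuffles, kappa_l is again an
   infinitesimal character.
   Grouping equal indices, the sum over nondecreasing lambda becomes the
   deconcatenation product of the exponentials of kappa_1, ..., kappa_s, hence
   beta * alpha is multiplicative for the shuffle product, as is 1 / gamma.  Two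
   shuffle characters that agree up to weight p differ in weight p + 1 by an
   infinitesimal character, which gives the existence of the corrected beta_j.
   In weight p + 1 the only summand of (beta * alpha)(mu) that sees a value of
   beta_j in weight p + 1 is b_j beta_j(mu), from the one-block splitting of mu;
   so the correction fixes exactly the defect. *)

Require Import Defs.
From mathcomp Require Import all_boot all_order all_algebra.
From mathcomp Require Import ring zify.
From mathcomp Require Import finmap monalg reals.

Set Implicit Arguments.
Unset Strict Implicit.
Unset Printing Implicit Defensive.

Import Order.TTheory GRing.Theory Num.Theory.

Local Open Scope ring_scope.

(** * Linear extension *)

Section LinearExtension.
Variables (R : realType) (K : choiceType) (f : K -> R).

Lemma lextE (x : {malg R[K]}) (D : {fset K}) :
  (msupp x `<=` D)%fset -> lext f x = \sum_(k <- D) x@_k * f k.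
Proof.
move=> sxD; rewrite /lext (big_fset_incl _ sxD) // => k _ /mcoeff_outdom ->.
by rewrite mul0r.
Qed.

Lemma lextD (x y : {malg R[K]}) : lext f (x + y) = lext f x + lext f y.
Proof.
rewrite (lextE (msuppD_le x y)) (lextE (fsubsetUl _ (msupp y))).
rewrite (lextE (fsubsetUr (msupp x) _)) -big_split /=.
by apply: eq_bigr => k _; rewrite mcoeffD mulrDl.
Qed.

Lemma lext_sum (I : Type) (r : seq I) (c : I -> R) (k : I -> K) :
  lext f (\sum_(i <- r) c i *: << k i >>) = \sum_(i <- r) c i * f (k i).
Proof.
have lext0 : lext f 0 = 0 by rewrite /lext msupp0 big_seq_fset0.
rewrite (big_morph _ lextD lext0); apply: eq_bigr => i _.
rewrite (lextE (D := [fset k i]%fset)) ?big_seq_fset1.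
  by rewrite mcoeffZ mcoeffUU mulr1.
exact: fsubset_trans (msuppZ_le _ _) msuppU_le.
Qed.

End LinearExtension.

(** * Deconcatenation and shuffles *)

Section Deconcatenation.
Variables (R : comNzRingType) (T : Type).
Implicit Types (f g : seq T -> R) (F G : seq T -> seq T -> R).
Implicit Types (a b : T) (u v : seq T).

Definition conv f g u : R :=
  \sum_(i < (size u).+1) f (take i u) * g (drop i u).

(** The deconcatenation product on the tensor square, for functions of two words. *)
Definition conv2 F G u v : R :=
  \sum_(i < (size u).+1) \sum_(j < (size v).+1)
     F (take i u) (take j v) * G (drop i u) (drop j v).

(** The linear extension of [f] at the shuffle product, as a list sum that avoids supports. *)
Definition shuffle_sum f u v : R := \sum_(w <- shuffle_words u v) f w.

Definition counit u : R := (nilp u)%:R.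

Lemma conv_nil f g : conv f g [::] = f [::] * g [::].
Proof. by rewrite /conv big_ord1. Qed.

Lemma conv_cons f g a u :
  conv f g (a :: u) = f [::] * g (a :: u) + conv (f \o cons a) g u.
Proof. by rewrite /conv big_ord_recl. Qed.

Lemma eq_conv f f' g g' : f =1 f' -> g =1 g' -> conv f g =1 conv f' g'.
Proof. by move=> ff' gg' u; apply: eq_bigr => i _; rewrite ff' gg'. Qed.

Lemma conv_counitl f u : conv counit f u = f u.
Proof.
rewrite /conv big_ord_recl take0 drop0 mul1r big1 ?addr0 // => i _.
by case: u i => [[]|x u i] //=; rewrite mul0r.
Qed.

Lemma convDl f f' g u :
  conv (fun w => f w + f' w) g u = conv f g u + conv f' g u.
Proof. by rewrite /conv -big_split; apply: eq_bigr => i _; rewrite mulrDl. Qed.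

Lemma convZl c f g u :
  conv (fun w => c * f w) g u = c * conv f g u.
Proof. by rewrite /conv mulr_sumr; apply: eq_bigr => i _; rewrite mulrA. Qed.

Lemma conv2_tensor f f' g g' u v :
  conv2 (fun x y => f x * f' y) (fun x y => g x * g' y) u v =
  conv f g u * conv f' g' v.
Proof.
rewrite /conv mulr_suml; apply: eq_bigr => i _; rewrite mulr_sumr.
by apply: eq_bigr => j _; rewrite mulrACA.
Qed.

Lemma eq_conv2 F F' G G' : F =2 F' -> G =2 G' -> conv2 F G =2 conv2 F' G'.
Proof.
move=> FF' GG' u v; apply: eq_bigr => i _; apply: eq_bigr => j _.
by rewrite FF' GG'.
Qed.

Lemma conv2Dl F F' G u v :
  conv2 (fun x y => F x y + F' x y) G u v = conv2 F G u v + conv2 F' G u v.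
Proof.
rewrite /conv2 -big_split; apply: eq_bigr => i _; rewrite -big_split.
by apply: eq_bigr => j _; rewrite mulrDl.
Qed.

Lemma conv2_sumr n F (G : nat -> seq T -> seq T -> R) u v :
  conv2 F (fun x y => \sum_(k < n) G k x y) u v =
  \sum_(k < n) conv2 F (G k) u v.
Proof.
rewrite /conv2 [RHS]exchange_big; apply: eq_bigr => i _ /=.
by rewrite [RHS]exchange_big; apply: eq_bigr => j _; rewrite mulr_sumr.
Qed.

Lemma shuffle_sum0l f v : shuffle_sum f [::] v = f v.
Proof. by rewrite /shuffle_sum big_seq1. Qed.

Lemma shuffle_sum0r f u : shuffle_sum f u [::] = f u.
Proof. by case: u => [|a u]; rewrite /shuffle_sum big_seq1. Qed.

Lemma shuffle_sum_cons f a u b v :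
  shuffle_sum f (a :: u) (b :: v) =
  shuffle_sum (f \o cons a) u (b :: v) + shuffle_sum (f \o cons b) (a :: u) v.
Proof. by rewrite /shuffle_sum big_cat !big_map. Qed.

Lemma eq_shuffle_sum f g : f =1 g -> shuffle_sum f =2 shuffle_sum g.
Proof.
by move=> fg u v; rewrite /shuffle_sum (eq_bigr _ (fun w _ => fg w)).
Qed.

Lemma shuffle_sumD f g u v :
  shuffle_sum (fun w => f w + g w) u v = shuffle_sum f u v + shuffle_sum g u v.
Proof. exact: big_split. Qed.

Lemma shuffle_sumZ c f u v :
  shuffle_sum (fun w => c * f w) u v = c * shuffle_sum f u v.
Proof. by rewrite /shuffle_sum mulr_sumr. Qed.

(* Deconcatenation is a morphism for the shuffle product. *)
Lemma shuffle_sum_conv f g u v :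
  shuffle_sum (conv f g) u v = conv2 (shuffle_sum f) (shuffle_sum g) u v.
Proof.
have [n] := ubnP (size u + size v); elim: n f u v => // n IHn f.
case=> [|a u].
  move=> v _; rewrite shuffle_sum0l /conv2 big_ord1.
  by apply: eq_bigr => j _; rewrite !shuffle_sum0l.
case=> [_|b v /= ltuv].
  rewrite shuffle_sum0r; apply: eq_bigr => i _.
  by rewrite big_ord1 !shuffle_sum0r.
rewrite shuffle_sum_cons (eq_shuffle_sum (conv_cons f g a)).
rewrite (eq_shuffle_sum (conv_cons f g b)) !shuffle_sumD !shuffle_sumZ.
rewrite addrACA -mulrDr -shuffle_sum_cons !IHn /=; try by lia.
(* On the right, the pair (0, 0) gives the term in [f [::]]. Pairs with exactly one zero index are
   boundary terms of the two sums on the left, and the remaining pairs combine by [shuffle_sum_cons]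
   on prefixes. *)
rewrite /conv2 [RHS]big_ord_recl [in RHS]big_ord_recl !take0 !drop0.
rewrite [in X in _ = X + _]shuffle_sum0l -addrA; congr (_ + _).
rewrite [X in _ + X = _]big_ord_recl addrCA; congr (_ + _).
  by apply: eq_bigr => j _; rewrite !take0 !drop0 !shuffle_sum0l.
rewrite -big_split; apply: eq_bigr => i _ /=.
rewrite [in X in X + _ = _]big_ord_recl [in RHS]big_ord_recl -addrA.
congr (_ + _); first by rewrite !take0 !shuffle_sum0r.
rewrite -big_split; apply: eq_bigr => j _ /=.
by rewrite shuffle_sum_cons mulrDl.
Qed.

Definition shuffle_character f :=
  forall u v, shuffle_sum f u v = f u * f v.

Lemma conv_character f g :
  shuffle_character f -> shuffle_character g -> shuffle_character (conv f g).
Proof.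
by move=> cf cg u v; rewrite shuffle_sum_conv (eq_conv2 cf cg) conv2_tensor.
Qed.

Lemma counit_character : shuffle_character counit.
Proof.
elim=> [|a u _] v; first by rewrite shuffle_sum0l mul1r.
elim: v => [|b v _]; first by rewrite shuffle_sum0r mulr1.
by rewrite mul0r shuffle_sum_cons /shuffle_sum !big1 ?addr0.
Qed.

End Deconcatenation.

Arguments counit R {T} u.

(** * Exponentials for the deconcatenation product *)

Section Exponential.
Variables (R : numFieldType) (T : Type) (kappa : seq T -> R).

Fixpoint div_power (k : nat) : seq T -> R :=
  if k is k'.+1 then fun u => k%:R^-1 * conv kappa (div_power k') u
  else counit R.

(** The cut at [size u] loses nothing when [kappa [::] = 0]: each of the k factors must then take at
    least one letter. *)
Definition conv_exp u : R := \sum_(k < (size u).+1) div_power k u.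

Hypothesis kappa0 : kappa [::] = 0.
Hypothesis kappaM : forall u v, ~~ nilp u -> ~~ nilp v ->
  shuffle_sum kappa u v = 0.

Lemma div_power_gt_size k u : (size u < k)%N -> div_power k u = 0.
Proof.
elim: k u => // k IHk u ltuk /=; rewrite /conv big_ord_recl take0 kappa0 mul0r.
rewrite add0r big1 ?mulr0 // => i _; rewrite IHk ?mulr0 // size_drop /= /bump.
by case: u i ltuk => [[]|x u i] //= ; lia.
Qed.

(** Primitivity in tensor form, valid for empty words too, so that [conv2_tensor] applies to each
    summand. *)
Lemma shuffle_sum_primitive u v :
  shuffle_sum kappa u v = kappa u * counit R v + counit R u * kappa v.
Proof.
case: u => [|a u]; first by rewrite shuffle_sum0l kappa0 mul0r add0r mul1r.
case: v => [|b v]; first by rewrite shuffle_sum0r kappa0 mulr1 mulr0 addr0.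
by rewrite kappaM // mulr0 mul0r addr0.
Qed.

Lemma div_powerS k u :
  conv kappa (div_power k) u = k.+1%:R * div_power k.+1 u.
Proof. by rewrite mulrA divff ?mul1r // pnatr_eq0. Qed.

(** The binomial formula for divided powers of the sum of the commuting elements kappa (x) counit
    and counit (x) kappa. *)
Lemma shuffle_sum_div_power k u v :
  shuffle_sum (div_power k) u v =
  \sum_(i < k.+1) div_power i u * div_power (k - i) v.
Proof.
elim: k u v => [|k IHk] u v.
  by rewrite big_ord1; apply: counit_character.
have nz : k.+1%:R != 0 :> R by rewrite pnatr_eq0.
rewrite /= shuffle_sumZ shuffle_sum_conv; apply: (mulfI nz).
rewrite mulrA divff // mul1r (eq_conv2 shuffle_sum_primitive IHk) conv2Dl.
rewrite !(conv2_sumr _ _ (fun i x y => div_power i x * div_power (k - i) y)).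
(* The two sums give the same products with weights i and k + 1 - i, which add up to the factor k +
   1 on the other side. *)
have -> : \sum_(i < k.+1) conv2 (fun x y => kappa x * counit R y)
     (fun x y => div_power i x * div_power (k - i) y) u v =
   \sum_(i < k.+2) i%:R * (div_power i u * div_power (k.+1 - i) v).
  rewrite [RHS]big_ord_recl mul0r add0r; apply: eq_bigr => i _.
  by rewrite conv2_tensor conv_counitl div_powerS mulrA.
have -> : \sum_(i < k.+1) conv2 (fun x y => counit R x * kappa y)
     (fun x y => div_power i x * div_power (k - i) y) u v =
   \sum_(i < k.+2) (k.+1 - i)%:R * (div_power i u * div_power (k.+1 - i) v).
  rewrite [RHS]big_ord_recr /= subnn mul0r addr0; apply: eq_bigr => i _.
  rewrite conv2_tensor conv_counitl div_powerS (subSn (ltnSE (ltn_ord i))).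
  exact: mulrCA.
rewrite mulr_sumr -big_split; apply: eq_bigr => i _ /=.
by rewrite -mulrDl -natrD (subnKC (ltnSE (ltn_ord i))).
Qed.

(* The powers of [kappa] are the coefficients of the polynomial
   exp('X kappa)(u), so that the triangular Cauchy product above becomes a
   product of polynomials, evaluated at 1. *)
Lemma conv_exp_character : shuffle_character conv_exp.
Proof.
pose E u := \poly_(k < (size u).+1) div_power k u.
have coefE u k : (E u)`_k = div_power k u.
  by rewrite coef_poly; case: ltnP => // /div_power_gt_size ->.
have ED u : conv_exp u = (E u).[1].
  by rewrite horner_poly; apply: eq_bigr => k _; rewrite expr1n mulr1.
move=> u v; rewrite (eq_shuffle_sum ED) !ED -hornerM /shuffle_sum -horner_sum.
congr _.[1]; apply/polyP => k; rewrite coef_sum coefM.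
transitivity (shuffle_sum (div_power k) u v).
  by apply: eq_bigr => w _; apply: coefE.
by rewrite shuffle_sum_div_power; apply: eq_bigr => i _; rewrite !coefE.
Qed.

End Exponential.

(** * Splittings into blocks and nondecreasing words *)

Section Splits.
Variable R : numFieldType.
Implicit Types (F G : seq (seq nat) -> R) (kappa : seq nat -> R).

Definition split_sum F mu : R := \sum_(pi <- splits mu) F pi.

(** Matches the second half of [splits], where m joins the first block; with no block to join, the
    value is 0. *)
Definition merge_head m F (pi : seq (seq nat)) : R :=
  if pi is q :: pi' then F ((m :: q) :: pi') else 0.

Lemma eq_split_sum F G : F =1 G -> split_sum F =1 split_sum G.
Proof. by move=> FG mu; apply: eq_bigr => pi _; apply: FG. Qed.

Lemma split_sum_nil F : split_sum F [::] = F [::].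
Proof. by rewrite /split_sum big_seq1. Qed.

Lemma split_sum_cons F m mu :
  split_sum F (m :: mu) =
  split_sum (F \o cons [:: m]) mu + split_sum (merge_head m F) mu.
Proof.
rewrite /split_sum big_cat big_map big_pmap /=; congr (_ + _).
by apply: eq_bigr => -[].
Qed.

Lemma split_sumD F G mu :
  split_sum (fun pi => F pi + G pi) mu = split_sum F mu + split_sum G mu.
Proof. exact: big_split. Qed.

Lemma split_sumZ c F mu :
  split_sum (fun pi => c * F pi) mu = c * split_sum F mu.
Proof. by rewrite /split_sum mulr_sumr. Qed.

Lemma merge_head_conv m F G pi :
  merge_head m (conv F G) pi =
  F [::] * merge_head m G pi + conv (merge_head m F) G pi.
Proof.
case: pi => [|q pi] /=; first by rewrite conv_nil mul0r mulr0 addr0.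
by rewrite !conv_cons /= mul0r add0r.
Qed.

(** Cutting a splitting between two blocks amounts to cutting mu and splitting both parts. Hence
    [split_sum] carries products on block words to products on multi-indices. *)
Lemma split_sum_conv F G mu :
  split_sum (conv F G) mu = conv (split_sum F) (split_sum G) mu.
Proof.
elim: mu F G => [|m mu IHmu] F G.
  by rewrite split_sum_nil !conv_nil !split_sum_nil.
rewrite split_sum_cons conv_cons split_sum_nil split_sum_cons.
rewrite (eq_split_sum (fun pi => conv_cons F G [:: m] pi)).
rewrite (eq_split_sum (merge_head_conv m F G)) !split_sumD !split_sumZ.
rewrite addrACA -mulrDr; congr (_ + _); rewrite !IHmu -convDl.
by apply: eq_conv => // w; rewrite [RHS]split_sum_cons.
Qed.

(** A lift of [kappa] to block words, which [split_sum] sends back to [kappa] on non-empty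
    multi-indices. *)
Definition single_block kappa (pi : seq (seq nat)) : R :=
  if pi is [:: x] then kappa x else 0.

Lemma split_sum_single_block kappa mu :
  split_sum (single_block kappa) mu = if nilp mu then 0 else kappa mu.
Proof.
elim: mu kappa => [|m mu IHmu] kappa; first by rewrite split_sum_nil.
have merge1 :
    merge_head m (single_block kappa) =1 single_block (kappa \o cons m).
  by case=> [|q []].
rewrite split_sum_cons (eq_split_sum merge1) IHmu.
case: mu {IHmu} => [|n mu]; first by rewrite split_sum_nil addr0.
by rewrite split_sum_cons /split_sum !big1 ?add0r // => -[].
Qed.

(** The exponential of [single_block kappa] on block words: each factor takes exactly one block. *)
Definition exp_blocks kappa (pi : seq (seq nat)) : R :=
  (size pi)`!%:R^-1 * \prod_(x <- pi) kappa x.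

Lemma div_power_split_sum kappa k mu : kappa [::] = 0 ->
  div_power kappa k mu =
  split_sum (fun pi => (size pi == k)%:R * exp_blocks kappa pi) mu.
Proof.
move=> kappa0; elim: k mu => [|k IHk] mu.
  case: mu => [|m mu]; last first.
    by rewrite split_sum_cons /split_sum !big1 ?addr0 // => -[|q pi] _ //=;
      rewrite mul0r.
  by rewrite split_sum_nil /exp_blocks big_nil fact0 invr1 !mulr1.
have single mu' : kappa mu' = split_sum (single_block kappa) mu'.
  by rewrite split_sum_single_block; case: mu'.
rewrite /= (eq_conv single IHk) -split_sum_conv -split_sumZ.
apply: eq_split_sum => -[|x pi].
  by rewrite conv_nil /= !mul0r mulr0.
rewrite conv_cons mul0r add0r.
have headK : single_block kappa \o cons x =1 (fun w => kappa x * counit R w).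
  by case=> [|y pi'] /=; rewrite ?mulr1 ?mulr0.
rewrite (eq_conv headK (frefl _)) convZl conv_counitl /exp_blocks /= eqSS.
case: eqP => [<-|_]; last by rewrite !mul0r !mulr0.
by rewrite big_cons factS natrM invfM; ring.
Qed.

Lemma size_splits mu pi : pi \in splits mu -> (size pi <= size mu)%N.
Proof.
rewrite mem_splits => /andP[pi0 /eqP <-]; elim: pi pi0 => //= -[|m q] pi IHpi.
  by rewrite inE.
rewrite inE /= size_cat ltnS => /IHpi le_pi.
exact: leq_trans le_pi (leq_addl _ _).
Qed.

(** The k-th divided power collects the splittings into k blocks. Blocks are non-empty, so every
    splitting is met for exactly one k up to [size mu]. *)
Lemma split_sum_exp_blocks kappa : kappa [::] = 0 ->
  split_sum (exp_blocks kappa) =1 conv_exp kappa.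
Proof.
move=> kappa0 mu; rewrite /conv_exp.
under eq_bigr do rewrite div_power_split_sum //.
rewrite exchange_big; apply: eq_big_seq => pi /size_splits le_pi.
rewrite -mulr_suml (bigD1 (inord (size pi))) //= inordK // eqxx big1 => [|k].
  by rewrite addr0 mul1r.
by rewrite -val_eqE /= inordK // eq_sym => /negPf->.
Qed.

End Splits.

(** * Nondecreasing words and their multiplicities *)

Section WeaklyIncreasing.
Variable s : nat.
Implicit Types (L l : seq 'I_s) (i : 'I_s).

(** For strictly increasing [L] these are the nondecreasing words of length k over [L]. The
    recursion exposes the multiplicity m of the first letter, which becomes a cut position in
    [conv]. *)
Fixpoint weak_words L (k : nat) : seq (seq 'I_s) :=
  if L is i :: L' then
    [seq nseq m i ++ l | m <- iota 0 k.+1, l <- weak_words L' (k - m)]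
  else if k is 0 then [:: [::]] else [::].

Lemma weak_words_cons i L k : weak_words (i :: L) k =
  [seq nseq m i ++ l | m <- iota 0 k.+1, l <- weak_words L (k - m)].
Proof. by []. Qed.

Let lei := fun i j : 'I_s => (i <= j)%N.
Let lti := fun i j : 'I_s => (i < j)%N.

Lemma mem_weak_words L k l : sorted lti L ->
  (l \in weak_words L k) = [&& size l == k, sorted lei l & all (mem L) l].
Proof.
have lei_trans : transitive lei by move=> x y z; apply: leq_trans.
elim: L k l => [|i L IHL] k l.
  by case: k l => [|k] [|x l] //= _; rewrite ?andbF.
rewrite weak_words_cons => iL; have L_sorted := path_sorted iL.
have lt_i : all (lti i) L.
  by apply: order_path_min iL => x y z; apply: ltn_trans.
apply/idP/idP.
  move/allpairsPdep => [m [l' [lem]]]; rewrite mem_iota /= in lem.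
  rewrite IHL // => /and3P[/eqP sz_l' l'_sorted l'L] ->.
  rewrite size_cat size_nseq sz_l' subnKC // eqxx all_cat /=.
  apply/andP; split; last first.
    apply/andP; split; first by apply/allP => x /nseqP[-> _]; apply: mem_head.
    by apply: sub_all l'L => x /= xL; rewrite inE xL orbT.
  have le_il' : all (lei i) l'.
    apply/allP => x /(allP l'L) /(allP lt_i); apply: ltnW.
  elim: m {lem sz_l'} => //= m IHm.
  rewrite path_sortedE // IHm andbT all_cat le_il' andbT all_nseq /lei leqnn.
  by rewrite orbT.
case/and3P => /eqP <- {k} l_sorted l_L.
(* As i lies below every letter of [L], all its copies stand at the front of the sorted word. *)
apply/allpairsPdep; exists (count_mem i l), [seq x <- l | x != i].
have cntP : count (fun x => x != i) l = (size l - count_mem i l)%N.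
  by rewrite -(count_predC (pred1 i) l) addKn.
split; first by rewrite mem_iota /= ltnS count_size.
  rewrite IHL // size_filter cntP eqxx /= (sorted_filter lei_trans) //=.
  rewrite all_filter; apply: sub_all l_L => x /=; rewrite inE.
  by case: eqP.
elim: l l_sorted l_L {cntP} => //= x l IHl.
rewrite path_sortedE // => /andP[le_xl l_sorted] /andP[xL lL].
have [->|neq_xi] := eqVneq x i; first by rewrite /= -IHl.
have lt_ix : lti i x.
  by move: xL; rewrite inE (negPf neq_xi) => /(allP lt_i).
have nil : i \notin l.
  by apply/negP => /(allP le_xl); rewrite /lei leqNgt -/(lti i x) lt_ix.
rewrite (count_memPn nil) /= (all_filterP _) //.
by apply/allP => y yl; apply: contraNneq nil => <-.
Qed.

Lemma weak_words_uniq L k : sorted lti L -> uniq (weak_words L k).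
Proof.
elim: L k => [|i L IHL] k; first by case: k.
rewrite weak_words_cons => iL; have L_sorted := path_sorted iL.
have niL : i \notin L.
  apply/negP => /(allP (order_path_min _ iL)).
  by rewrite /lti ltnn => /(_ (fun x y z => @ltn_trans _ _ _)).
apply: allpairs_uniq_dep => [|m _|]; rewrite ?iota_uniq ?IHL //.
(* The remaining word is free of i, so counting i recovers m. *)
have cnt0 l k' : l \in weak_words L k' -> count_mem i l = 0%N.
  rewrite mem_weak_words // => /and3P[_ _ /allP lL].
  by apply/count_memPn; apply: contra niL => /lL.
move=> _ _ /allpairsPdep[m [l [_ Hl ->]]] /allpairsPdep[m' [l' [_ Hl' ->]]] /=.
move=> eq_ml; have := congr1 (count_mem i) eq_ml.
rewrite !count_cat !count_nseq /= eqxx !mul1n (cnt0 _ _ Hl) (cnt0 _ _ Hl').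
rewrite !addn0 => eq_m; rewrite -{}eq_m in eq_ml *.
by move/eqP: eq_ml; rewrite eqseq_cat // eqxx => /eqP ->.
Qed.

Lemma enum_ord_ltn_sorted : sorted lti (enum 'I_s).
Proof.
have := iota_ltn_sorted 0 s; rewrite -val_enum_ord sorted_map.
exact.
Qed.

Lemma sum_sorted_tuples (V : nmodType) k (F : seq 'I_s -> V) :
  \sum_(l : k.-tuple 'I_s | sorted lei l) F l =
  \sum_(l <- weak_words (enum 'I_s) k) F l.
Proof.
rewrite -big_filter -(big_map val predT F) /=.
apply: perm_big; apply: uniq_perm.
- by rewrite (map_inj_uniq val_inj) filter_uniq // index_enum_uniq.
- exact: weak_words_uniq enum_ord_ltn_sorted.
move=> l; rewrite (mem_weak_words _ _ enum_ord_ltn_sorted); apply/mapP/and3P.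
  case=> t; rewrite mem_filter => /andP[t_sorted _] ->.
  rewrite size_tuple eqxx t_sorted; split=> //.
  by apply/allP => x _ /=; rewrite mem_enum.
case=> sz_l l_sorted _; exists (Tuple sz_l) => //.
by rewrite mem_filter l_sorted mem_index_enum.
Qed.

Lemma mult_fact_nseq_cat i m l :
  i \notin l -> mult_fact (nseq m i ++ l) = (m`! * mult_fact l)%N.
Proof.
move=> nil; rewrite /mult_fact (bigD1 i) //= [in RHS](bigD1 i) //= mulnA.
rewrite count_cat count_nseq /= eqxx mul1n (count_memPn nil) addn0 muln1.
congr muln; apply: eq_bigr => j neq_ji.
by rewrite count_cat count_nseq /= eq_sym (negPf neq_ji).
Qed.

(** A nondecreasing word cuts [pi] into consecutive segments, one per letter of [L], and its inverse
    multiplicity factorial splits into one 1/m! per segment. This is a product of exponentials. *)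
Lemma weak_words_conv (R : numFieldType) (T : Type) (K : 'I_s -> T -> R) L pi :
  sorted lti L ->
  \sum_(l <- weak_words L (size pi))
    (mult_fact l)%:R^-1 * \prod_(x <- zip l pi) K x.1 x.2 =
  foldr (fun i => conv (fun ps => (size ps)`!%:R^-1 * \prod_(x <- ps) K i x))
    (counit R) L pi.
Proof.
elim: L pi => [|i L IHL] pi.
  case: pi => [|x pi] _ /=; last by rewrite big_nil.
  rewrite big_seq1 big_nil mulr1 /mult_fact.
  by rewrite big1 ?invr1 // => j _; rewrite fact0.
move=> iL; have L_sorted := path_sorted iL.
have niL : i \notin L.
  apply/negP => /(allP (order_path_min _ iL)).
  by rewrite /lti ltnn => /(_ (fun x y z => @ltn_trans _ _ _)).
rewrite weak_words_cons big_allpairs_dep -{1}[_.+1]subn0 -/(index_iota 0 _).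
rewrite big_mkord [RHS]/= [RHS]/conv.
apply: eq_bigr => -[m ltm] _ /=; have lem : (m <= size pi)%N by rewrite -ltnS.
rewrite -IHL // size_drop mulr_sumr; apply: eq_big_seq => l.
rewrite mem_weak_words // => /and3P[_ _ /allP lL].
have nil : i \notin l by apply: contra niL => /lL.
have sz_take : size (take m pi) = m by rewrite size_takel.
rewrite mult_fact_nseq_cat // natrM invfM -[in zip _ pi](cat_take_drop m pi).
rewrite zip_cat ?size_nseq // big_cat /= mulrACA sz_take.
congr (_ * _ * _); rewrite -{1}sz_take.
by elim: (take m pi) => [|x ps IHps]; rewrite ?big_nil //= !big_cons IHps.
Qed.

End WeaklyIncreasing.

(** * Translation of letters *)

Lemma below_cons m mu :
  below (m :: mu) = [seq q :: r | q <- iota 0 m.+1, r <- below mu].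
Proof. by []. Qed.

Section LetterShift.
Variables (R : comNzRingType) (c : R).
Implicit Types (f : seq nat -> R) (mu nu : seq nat).

(** The composite of f with the letterwise substitution T at the constant [c], expanded in all
    letters at once. *)
Definition shift f mu : R :=
  \sum_(q <- below mu) (mbinom mu q)%:R * c ^+ sumn q * f (mdiff mu q).

Lemma shift_nil f : shift f [::] = f [::].
Proof. by rewrite /shift big_seq1 /mbinom big_nil !mul1r. Qed.

Lemma shift_cons f m mu :
  shift f (m :: mu) =
  \sum_(q < m.+1) 'C(m, q)%:R * c ^+ q * shift (f \o cons (m - q)%N) mu.
Proof.
rewrite /shift below_cons big_allpairs_dep -{1}[m.+1]subn0 -/(index_iota 0 _).
rewrite big_mkord; apply: eq_bigr => q _; rewrite mulr_sumr; apply: eq_bigr => r _.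
by rewrite /mbinom big_cons /= natrM exprD mulrACA -!mulrA.
Qed.

Lemma eq_shift f g : f =1 g -> shift f =1 shift g.
Proof. by move=> fg mu; apply: eq_bigr => q _; rewrite fg. Qed.

Lemma shiftD f g mu :
  shift (fun w => f w + g w) mu = shift f mu + shift g mu.
Proof. by rewrite /shift -big_split; apply: eq_bigr => q _; rewrite mulrDr. Qed.

Lemma shift_sum n (k : nat -> R) (f : nat -> seq nat -> R) mu :
  shift (fun w => \sum_(i < n) k i * f i w) mu =
  \sum_(i < n) k i * shift (f i) mu.
Proof.
rewrite /shift; under [RHS]eq_bigr do rewrite mulr_sumr.
rewrite [RHS]exchange_big; apply: eq_bigr => q _ /=.
by rewrite mulr_sumr; apply: eq_bigr => i _; rewrite mulrCA.
Qed.

Lemma shift_eq0 f mu : ~~ nilp mu -> (forall nu, ~~ nilp nu -> f nu = 0) ->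
  shift f mu = 0.
Proof.
case: mu => // m mu _ f0; rewrite shift_cons big1 // => q _.
by rewrite /shift big1 ?mulr0 // => r _ /=; rewrite f0 ?mulr0.
Qed.

(** T acts on each letter separately and a shuffle only interleaves letters. The nested shifts apply
    T to the two words independently. *)
Lemma shuffle_sum_shift f mu nu :
  shuffle_sum (shift f) mu nu =
  shift (fun mu' => shift (shuffle_sum f mu') nu) mu.
Proof.
have [n] := ubnP (size mu + size nu); elim: n f mu nu => // n IHn f.
have shuffle_shift_cons (g : seq nat -> R) a x y :
    (size x + size y < n)%N ->
  shuffle_sum (shift g \o cons a) x y =
  \sum_(q < a.+1) 'C(a, q)%:R * c ^+ q *
    shift (fun x' => shift (shuffle_sum (g \o cons (a - q)%N) x') y) x.
  move=> ltxy; rewrite (eq_shuffle_sum (fun w => shift_cons g a w)).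
  rewrite /shuffle_sum exchange_big; apply: eq_bigr => q _ /=.
  by rewrite -mulr_sumr -/(shuffle_sum _ _ _) IHn.
case=> [|a u].
  move=> v _; rewrite shuffle_sum0l shift_nil.
  by apply: eq_shift => w; rewrite shuffle_sum0l.
case=> [_|b v /= ltuv].
  rewrite shuffle_sum0r; apply: eq_shift => w.
  by rewrite shift_nil shuffle_sum0r.
rewrite shuffle_sum_cons !shuffle_shift_cons /=; try by lia.
under [X in _ + X]eq_bigr => q _ do rewrite shift_cons mulr_sumr.
rewrite shift_cons.
under [RHS]eq_bigr => q _.
  under eq_shift => w.
    rewrite /= shift_cons.
    under eq_bigr => r _.
      rewrite (eq_shift (g := fun v' =>
        shuffle_sum (f \o cons (a - q)%N) w ((b - r)%N :: v') +
        shuffle_sum (f \o cons (b - r)%N) ((a - q)%N :: w) v')); last first.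
        by move=> v' /=; rewrite shuffle_sum_cons.
      rewrite shiftD mulrDr. over.
    rewrite big_split. over.
  rewrite /= shiftD mulrDr. over.
rewrite [RHS]big_split /=; congr (_ + _).
  apply: eq_bigr => q _; congr (_ * _); apply: eq_shift => w.
  by rewrite shift_cons.
(* When b comes first, its substitution is the outer sum on the left, but on the right it sits
   inside the shift of the other word. *)
rewrite exchange_big; apply: eq_bigr => q _ /=.
rewrite (shift_sum _ (fun r => 'C(b, r)%:R * c ^+ r) (fun r w => shift
  (shuffle_sum (f \o cons (b - r)%N) ((a - q)%N :: w)) v)) mulr_sumr.
by apply: eq_bigr => r _; rewrite mulrCA.
Qed.

(** T preserves lengths, so both words stay non-empty. *)
Lemma shift_primitive f mu nu :
  (forall x y, ~~ nilp x -> ~~ nilp y -> shuffle_sum f x y = 0) ->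
  ~~ nilp mu -> ~~ nilp nu -> shuffle_sum (shift f) mu nu = 0.
Proof.
move=> f0 mu0 nu0; rewrite shuffle_sum_shift; apply: shift_eq0 => // x x0.
by apply: shift_eq0 => // y; apply: f0.
Qed.

End LetterShift.

(** * The character 1 / gamma *)

Section InverseGamma.

Lemma weight_rcons u m : weight (rcons u m) = (weight u + m.+1)%N.
Proof. by rewrite /weight size_rcons sumn_rcons; lia. Qed.

Lemma gamma_rcons u m : gamma (rcons u m) = (gamma u * weight (rcons u m))%N.
Proof.
rewrite /gamma size_rcons big_nat_recr //= -(size_rcons u m) take_size.
congr (_ * _)%N; apply: eq_big_nat => l /andP[_].
by rewrite size_rcons ltnS -cats1 => /takel_cat->.
Qed.

Lemma weight_shuffle_words u v w :
  w \in shuffle_words u v -> weight w = (weight u + weight v)%N.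
Proof.
have weight_cons x y : weight (x :: y) = (x.+1 + weight y)%N.
  by rewrite /weight /=; lia.
elim: u v w => [|a u IHu] v w; first by rewrite inE => /eqP->.
elim: v w => [|b v IHv] w; first by rewrite inE => /eqP->; rewrite addn0.
rewrite mem_cat => /orP[] /mapP[w' Hw' ->]; rewrite weight_cons.
  by rewrite (IHu _ _ Hw') (weight_cons a) addnA.
by rewrite (IHv _ Hw') (weight_cons b v); lia.
Qed.

(** The shuffle recursion at the last letter, suited to [gamma], which gains one factor when a
    letter is appended. *)
Lemma shuffle_sum_rcons (R : comNzRingType) (T : Type) (f : seq T -> R)
    u a v b :
  shuffle_sum f (rcons u a) (rcons v b) =
  shuffle_sum (f \o rcons^~ a) u (rcons v b) +
  shuffle_sum (f \o rcons^~ b) (rcons u a) v.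
Proof.
have [n] := ubnP (size u + size v); elim: n f u v => // n IHn f u v.
case: u v => [|x u] [|y v] /= ltn; rewrite !shuffle_sum_cons ?shuffle_sum0l
  ?shuffle_sum0r //=.
- by rewrite addrC.
- by rewrite (IHn _ [::] v) // shuffle_sum0l /= addrCA.
- rewrite (IHn _ u [::]) ?shuffle_sum0r /= 1?addrAC //; lia.
rewrite (IHn _ u (y :: v)) ?(IHn _ (x :: u) v) /=; try by lia.
exact: addrACA.
Qed.

Lemma gamma_neq0 u : gamma u != 0%N.
Proof.
elim/last_ind: u => [|u m IHu]; first by rewrite /gamma big_nil.
by rewrite gamma_rcons weight_rcons muln_eq0 negb_or IHu addnS.
Qed.

(** All shuffles of two words share the total weight W, hence the last factor of [gamma]. Removing
    the last letter leaves 1/W times two products, whose sum is right because W is the sum of both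
    weights. *)
Lemma inv_gamma_character (R : numFieldType) :
  shuffle_character (fun u => (gamma u)%:R^-1 : R).
Proof.
move=> u v; have [n] := ubnP (size u + size v); elim: n u v => // n IHn u v.
have gamma0 : (gamma [::])%:R^-1 = 1 :> R by rewrite /gamma big_nil invr1.
case/lastP: u => [_|u a]; first by rewrite shuffle_sum0l gamma0 mul1r.
case/lastP: v => [_|v b]; first by rewrite shuffle_sum0r gamma0 mulr1.
rewrite !size_rcons => ltuv; rewrite shuffle_sum_rcons.
pose W := (weight (rcons u a) + weight (rcons v b))%N.
have -> : shuffle_sum ((fun w => (gamma w)%:R^-1) \o rcons^~ a) u (rcons v b)
    = W%:R^-1 * ((gamma u)%:R^-1 * (gamma (rcons v b))%:R^-1) :> R.
  rewrite -IHn ?size_rcons; last by lia.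
  rewrite -shuffle_sumZ; apply: eq_big_seq => w /weight_shuffle_words ww /=.
  rewrite gamma_rcons natrM invfM mulrC; congr (_%:R^-1 * _).
  by rewrite weight_rcons ww /W !weight_rcons; lia.
have -> : shuffle_sum ((fun w => (gamma w)%:R^-1) \o rcons^~ b) (rcons u a) v
    = W%:R^-1 * ((gamma (rcons u a))%:R^-1 * (gamma v)%:R^-1) :> R.
  rewrite -IHn ?size_rcons; last by lia.
  rewrite -shuffle_sumZ; apply: eq_big_seq => w /weight_shuffle_words ww /=.
  rewrite gamma_rcons natrM invfM mulrC; congr (_%:R^-1 * _).
  by rewrite weight_rcons ww /W !weight_rcons; lia.
have weight_neq0 x m : (weight (rcons x m))%:R != 0 :> R.
  by rewrite weight_rcons addnS pnatr_eq0.
have W_neq0 : (weight (rcons u a))%:R + (weight (rcons v b))%:R != 0 :> R.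
  by rewrite -natrD weight_rcons addnS pnatr_eq0.
have gamma_neq0R x : (gamma x)%:R != 0 :> R by rewrite pnatr_eq0 gamma_neq0.
rewrite /W !gamma_rcons !natrM natrD; field.
by rewrite W_neq0 !weight_neq0 !gamma_neq0R.
Qed.

End InverseGamma.

(** * The character star *)

Section Star.
Variables (R : realType) (s : nat) (a b : 'I_s -> R).
Implicit Types (beta : 'I_s -> seq nat -> R) (lam : seq 'I_s).

Lemma inf_characterP (f : seq nat -> R) : inf_character f <->
  f [::] = 0 /\
  forall u v, ~~ nilp u -> ~~ nilp v -> shuffle_sum f u v = 0.
Proof.
have lext_shuffle u v : lext f (shuffle R u v) = shuffle_sum f u v.
  rewrite /shuffle; under eq_bigr do rewrite -[<< _ >>]scale1r.
  rewrite lext_sum.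
  by apply: eq_bigr => w _; rewrite mul1r.
split=> -[f0 fM]; split=> // u v.
  by rewrite -lext_shuffle /nilp !size_eq0; apply: fM.
by rewrite lext_shuffle -!size_eq0; apply: fM.
Qed.

(* B(stage beta l) = e^(- c_l h A) (b_l h B_l) e^(c_l h A) *)
Definition stage beta (l : 'I_s) (x : seq nat) : R :=
  b l * shift (abscissa a l) (beta l) x.

Lemma stageE beta l x : stage beta l x = \sum_(q <- below x)
  (mbinom x q)%:R * beta l (mdiff x q) * (b l * abscissa a l ^+ sumn q).
Proof.
by rewrite /stage /shift mulr_sumr; apply: eq_bigr => q _; ring.
Qed.

(** Distributivity: the p_i are chosen independently, and binomials, [beta_word] and [alpha] all
    factor over the blocks. *)
Lemma sum_cartprod_below beta lam pi : size lam = size pi ->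
  \sum_(p <- cartprod (map below pi))
    (\prod_(x <- zip pi p) mbinom x.1 x.2)%N%:R *
    (beta_word beta lam [seq mdiff x.1 x.2 | x <- zip pi p] *
     alpha a b (map sumn p) lam) =
  \prod_(x <- zip lam pi) stage beta x.1 x.2.
Proof.
elim: lam pi => [|l lam IHlam] [|x pi] //=.
  by move=> _; rewrite big_seq1 /beta_word /alpha !big_nil !mulr1.
case=> /IHlam {}IHlam; rewrite big_allpairs_dep big_cons /= -IHlam stageE.
rewrite mulr_suml; apply: eq_bigr => q _; rewrite mulr_sumr.
apply: eq_bigr => p _; rewrite /beta_word /alpha /= !big_cons natrM /=.
ring.
Qed.

Lemma size_cartprod (T : eqType) (ss : seq (seq T)) p :
  p \in cartprod ss -> size p = size ss.
Proof.
elim: ss p => [|t ss IHss] p /=; first by rewrite inE => /eqP->.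
by case/allpairsPdep => x [y [_ /IHss <- ->]].
Qed.

Definition stage_blocks beta (pi : seq (seq nat)) : R :=
  \sum_(lam <- weak_words (enum 'I_s) (size pi))
    (mult_fact lam)%:R^-1 * \prod_(x <- zip lam pi) stage beta x.1 x.2.

Lemma starE beta mu : star a b beta mu = split_sum (stage_blocks beta) mu.
Proof.
rewrite /star /coproduct.
have -> (F : seq (seq nat) * seq nat -> R) : lext F (\sum_(pi <- splits mu)
    \sum_(p <- cartprod (map below pi))
    (\prod_(x <- zip pi p) mbinom x.1 x.2)%N%:R *:
      << ([seq mdiff x.1 x.2 | x <- zip pi p], map sumn p) >>) =
   \sum_(pi <- splits mu) \sum_(p <- cartprod (map below pi))
    (\prod_(x <- zip pi p) mbinom x.1 x.2)%N%:R *
    F ([seq mdiff x.1 x.2 | x <- zip pi p], map sumn p).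
  have lextF0 : lext F 0 = 0 by rewrite /lext msupp0 big_seq_fset0.
  rewrite (big_morph _ (lextD F) lextF0); apply: eq_bigr => pi _.
  exact: lext_sum.
apply: eq_bigr => pi _; rewrite /stage_blocks.
under [RHS]eq_big_seq => lam.
  rewrite mem_weak_words ?enum_ord_ltn_sorted // => /and3P[/eqP sz_lam _ _].
  rewrite -sum_cartprod_below // mulr_sumr.
  over.
(* The length of lambda is read off [map sumn p], which has one entry per block of [pi]. *)
rewrite [RHS]exchange_big; apply: eq_big_seq => p /size_cartprod.
rewrite size_map => sz_p /=.
rewrite (sum_sorted_tuples _ (fun lam => (mult_fact lam)%:R^-1 *
  beta_word beta lam [seq mdiff x.1 x.2 | x <- zip pi p] *
  alpha a b (map sumn p) lam)) size_map sz_p mulr_sumr.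
by apply: eq_bigr => lam _; rewrite -mulrA mulrCA.
Qed.

Lemma star_character beta : (forall l, inf_character (beta l)) ->
  shuffle_character (star a b beta).
Proof.
move=> beta_inf u v; rewrite (eq_shuffle_sum (starE beta)) !starE.
(* The partial product over the stages in [L], generalised from [enum 'I_s] to allow induction on
   [L]. *)
pose E L := split_sum (foldr (fun l => conv (exp_blocks (stage beta l)))
  (counit R) L).
have stage0 l : stage beta l [::] = 0.
  by have [+ _] := beta_inf l; rewrite /stage shift_nil => ->; rewrite mulr0.
have stageM l x y : ~~ nilp x -> ~~ nilp y ->
    shuffle_sum (stage beta l) x y = 0.
  have /inf_characterP[_ beta_prim] := beta_inf l.
  by move=> x0 y0; rewrite shuffle_sumZ (shift_primitive _ beta_prim) ?mulr0.
have star_foldr w : split_sum (stage_blocks beta) w = E (enum 'I_s) w.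
  apply: eq_split_sum => pi.
  exact: (weak_words_conv (stage beta) pi (enum_ord_ltn_sorted s)).
suffices E_char L : shuffle_character (E L).
  by rewrite (eq_shuffle_sum star_foldr) !star_foldr; apply: E_char.
elim: L => {u v} [|l L IHL] u v.
  have E0 w : E [::] w = counit R w.
    case: w => [|m w]; first by rewrite /E split_sum_nil.
    by rewrite /E split_sum_cons /split_sum !big1 ?addr0 // => -[].
  by rewrite (eq_shuffle_sum E0) !E0; apply: counit_character.
have E_cons w : E (l :: L) w = conv (conv_exp (stage beta l)) (E L) w.
  rewrite /E /= split_sum_conv; apply: eq_conv => //.
  exact: split_sum_exp_blocks (stage0 l).
rewrite (eq_shuffle_sum E_cons) !E_cons.
exact: conv_character (conv_exp_character (stage0 l) (stageM l)) IHL u v.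
Qed.

End Star.

(** * Dependence of star on the values of beta, by weight *)

Section TopWeight.
Variable R : realType.
Implicit Types (f g : seq nat -> R) (x mu : seq nat).

Lemma weight_below x q : q \in below x -> (weight (mdiff x q) <= weight x)%N.
Proof.
elim: x q => [|m x IHx] q; first by rewrite inE => /eqP->.
rewrite below_cons => /allpairsPdep[k [r [_ /IHx + ->]]].
by rewrite /weight /mdiff /= !size_map; lia.
Qed.

Lemma eq_shift_weight c f g x :
  (forall y, (weight y <= weight x)%N -> f y = g y) ->
  shift c f x = shift c g x.
Proof.
by move=> fg; apply: eq_big_seq => q /weight_below wq; rewrite fg.
Qed.

(** Every nonzero q lowers the weight, so only the leading term of T survives. *)
Lemma shift_top c f x :
  (forall y, (weight y < weight x)%N -> f y = 0) -> shift c f x = f x.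
Proof.
elim: x f => [|m x IHx] f f0; first by rewrite shift_nil.
rewrite shift_cons big_ord_recl bin0 expr0 !mul1r subn0 big1 => [|q _].
  rewrite addr0 IHx // => y lt_yx; apply: f0.
  by move: lt_yx; rewrite /weight /=; lia.
rewrite (@eq_shift_weight _ _ (fun=> 0)) => [|y le_yx].
  by rewrite /shift big1 ?mulr0 // => r _; rewrite mulr0.
apply: f0; move: le_yx; rewrite /weight /= /bump /=.
by have := ltn_ord q; lia.
Qed.

(** Some other block is present, and being non-empty it has positive weight. *)
Lemma weight_splits mu pi x : pi \in splits mu -> x \in pi ->
  pi != [:: mu] -> (weight x < weight mu)%N.
Proof.
rewrite mem_splits => /andP[+ /eqP <-] x_pi.
case/splitPr: pi / x_pi => pi1 pi2.
have w0 y : y != [::] -> (0 < weight y)%N by case: y.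
rewrite mem_cat inE !negb_or => /and3P[].
case: pi1 => [|y pi1] /=.
  case: pi2 => [|z pi2] _ _ /=; first by rewrite cats0 eqxx.
  rewrite inE negb_or eq_sym => /andP[/w0 + _] _.
  by rewrite /weight !size_cat !sumn_cat; lia.
rewrite inE negb_or eq_sym => /andP[/w0 + _] _ _ _.
by rewrite flatten_cat /= /weight !size_cat !sumn_cat; lia.
Qed.

Variables (s : nat) (a b : 'I_s -> R).

Lemma eq_stage_blocks (beta beta' : 'I_s -> seq nat -> R) pi :
  (forall l x, x \in pi -> stage a b beta l x = stage a b beta' l x) ->
  stage_blocks a b beta pi = stage_blocks a b beta' pi.
Proof.
move=> eq_st; apply: eq_bigr => lam _; congr (_ * _).
apply: eq_big_seq => -[l x] /= lx; apply: eq_st.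
elim: lam pi lx => [|i lam IHlam] [|y pi] //=; rewrite !inE.
by case/orP=> [/eqP[_ ->]|/IHlam ->]; rewrite ?eqxx ?orbT.
Qed.

Lemma eq_star (beta beta' : 'I_s -> seq nat -> R) mu :
  (forall l y, (weight y <= weight mu)%N -> beta l y = beta' l y) ->
  star a b beta mu = star a b beta' mu.
Proof.
move=> eq_beta; rewrite !starE; apply: eq_big_seq => pi pi_mu.
apply: eq_stage_blocks => l x x_pi; congr (_ * _).
apply: eq_shift_weight => y le_yx; apply: eq_beta; apply: leq_trans le_yx _.
have [def_pi|neq] := eqVneq pi [:: mu]; last first.
  exact: ltnW (weight_splits pi_mu x_pi neq).
by move: x_pi; rewrite def_pi inE => /eqP->.
Qed.

Lemma stage_blocks1 (beta : 'I_s -> seq nat -> R) x :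
  stage_blocks a b beta [:: x] = \sum_l stage a b beta l x.
Proof.
rewrite /stage_blocks /=.
rewrite -(sum_sorted_tuples 1 (fun lam => (mult_fact lam)%:R^-1 *
  \prod_(y <- zip lam [:: x]) stage a b beta y.1 y.2)).
rewrite (reindex (fun l => [tuple l])) /=; last first.
  exists (@thead _ _) => [l _|t _]; first exact: theadE.
  rewrite [RHS]tuple_eta; apply: val_inj.
  by case/tupleP: t => y t; rewrite tuple0.
apply: eq_bigr => l _; rewrite big_seq1 /mult_fact (bigD1 l) //= eqxx.
rewrite big1 ?invr1 ?mul1r // => i /negPf neq_il.
by rewrite eq_sym neq_il.
Qed.

(* The summand of star in which a whole multi-index of top weight is fed to
   beta comes from the one-block splitting of mu. *)
Lemma star_top (beta beta' : 'I_s -> seq nat -> R) mu : mu != [::] ->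
  (forall l y, (weight y < weight mu)%N -> beta l y = beta' l y) ->
  star a b beta mu - star a b beta' mu = \sum_l b l * (beta l mu - beta' l mu).
Proof.
move=> mu0 eq_beta; have mu_split : [:: mu] \in splits mu.
  by rewrite mem_splits inE eq_sym mu0 /= cats0 eqxx.
rewrite !starE /split_sum (bigD1_seq _ mu_split (splits_uniq mu)) /=.
rewrite [in X in _ - X](bigD1_seq _ mu_split (splits_uniq mu)) /=.
rewrite !stage_blocks1 opprD addrACA -!sumrB [X in _ + X]big1_seq ?addr0.
  apply: eq_bigr => l _; rewrite -mulrBr.
  congr (_ * _).
  (* By linearity the difference of the two shifts is the shift of a function that vanishes below
     the weight of mu. *)
  rewrite -[RHS](@shift_top (abscissa a l) (fun y => beta l y - beta' l y)).
    by rewrite /shift -sumrB; apply: eq_bigr => q _; rewrite mulrBr.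
  by move=> y lt_y; rewrite eq_beta ?subrr.
move=> pi /andP[neq_pi pi_mu]; apply/eqP; rewrite subr_eq0; apply/eqP.
apply: eq_stage_blocks => l x x_pi; congr (_ * _).
apply: eq_shift_weight => y le_yx; apply: eq_beta; apply: leq_ltn_trans le_yx _.
exact: weight_splits pi_mu x_pi neq_pi.
Qed.

End TopWeight.

Theorem theorem5p4 (R : realType) (s p : nat) (a b : 'I_s -> R)
    (beta : 'I_s -> seq nat -> R) (j : 'I_s)
    (hmethod : gen_mod_splitting a beta)
    (horder : has_order a b beta p)
    (hvanish : forall mu : seq nat, weight mu = p.+1 -> beta j mu = 0)
    (hb : alpha a b [:: 0%N] [:: j] != 0) :
  (exists bt : seq nat -> R,
     is_correction a b beta p j bt /\ inf_character bt) /\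
  (forall bt : seq nat -> R,
     is_correction a b beta p j bt -> inf_character bt ->
     gen_mod_splitting a (replace_beta beta j bt) /\
     has_order a b (replace_beta beta j bt) p.+1).
Proof.
have [sum_a beta_inf] := hmethod.
have [[bj0 bj_prim] bj1] : (beta j [::] = 0 /\ forall u v, ~~ nilp u ->
    ~~ nilp v -> shuffle_sum (beta j) u v = 0) /\ beta j [:: 0%N] = 1.
  by have [/inf_characterP] := beta_inf j.
(* For p = 0 the vanishing in weight 1 would contradict [beta j [:: 0] = 1]. With p positive, the
   correction leaves that value unchanged. *)
have p_gt0 : (0 < p)%N.
  rewrite lt0n; apply: contra_eq_neq bj1 => p0.
  by rewrite hvanish ?p0 // eq_sym oner_eq0.
split=> [|bt [bt_low bt_top] bt_inf].
  (* The free values above weight p + 1 are set to 0. Shuffles are homogeneous in weight, so each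
     shuffle relation falls under a single case. *)
  pose bt mu := if (weight mu <= p)%N then beta j mu
    else if weight mu == p.+1 then
      (alpha a b [:: 0%N] [:: j])^-1 * ((gamma mu)%:R^-1 - star a b beta mu)
    else 0.
  exists bt; split.
    split=> mu; rewrite /bt; first by move=> ->.
    by move=> ->; rewrite ltnn eqxx.
  apply/inf_characterP; split=> [|u v u0 v0]; first by rewrite /bt.
  have w0 (w : seq nat) : ~~ nilp w -> (0 < weight w)%N by case: w.
  have [le_uv|lt_uv] := leqP (weight u + weight v)%N p.
    rewrite -(bj_prim u v u0 v0); apply: eq_big_seq => w /weight_shuffle_words.
    by rewrite /bt => ->; rewrite le_uv.
  have [eq_uv|neq_uv] := eqVneq (weight u + weight v)%N p.+1; last first.
    apply: big1_seq => w /andP[_ /weight_shuffle_words].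
    by rewrite /bt => ->; rewrite leqNgt lt_uv (negPf neq_uv).
  (* Both words are non-empty, so each has weight at most p, where the two characters agree; hence
     they also agree on the shuffle. *)
  have le_up : (weight u <= p)%N by have := w0 v v0; lia.
  have le_vp : (weight v <= p)%N by have := w0 u u0; lia.
  transitivity ((alpha a b [:: 0%N] [:: j])^-1 *
      (shuffle_sum (fun w => (gamma w)%:R^-1) u v -
       shuffle_sum (star a b beta) u v)).
    rewrite /shuffle_sum -sumrB mulr_sumr; apply: eq_big_seq => w.
    by move/weight_shuffle_words; rewrite /bt => ->; rewrite eq_uv ltnn eqxx.
  rewrite inv_gamma_character star_character => [|l]; last first.
    by have [] := beta_inf l.
  by rewrite !horder // subrr mulr0.
split; first split=> // l.
  by rewrite /replace_beta; case: eqP => // _; rewrite bt_low.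
move=> mu; rewrite leq_eqVlt ltnS => /orP[/eqP w_mu|le_mu]; last first.
  rewrite -horder //; apply: eq_star => l y le_y.
  rewrite /replace_beta; case: eqP => // ->.
  by rewrite bt_low // (leq_trans le_y).
have mu0 : mu != [::] by apply: contra_eq_neq w_mu => ->.
have eq_below l y : (weight y < weight mu)%N ->
    replace_beta beta j bt l y = beta l y.
  rewrite w_mu ltnS /replace_beta => le_y.
  by case: eqP => // ->; rewrite bt_low.
have := star_top a b mu0 eq_below.
rewrite (bigD1 j) //= big1 => [|l /negPf neq_lj]; last first.
  by rewrite /replace_beta neq_lj subrr mulr0.
have alphaE : alpha a b [:: 0%N] [:: j] = b j.
  by rewrite /alpha /= big_seq1 expr0 mulr1.
(* As [beta j mu] is 0, star changes by b_j times [bt mu], which is exactly the defect. *)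
rewrite /replace_beta eqxx addr0 bt_top // hvanish // subr0 alphaE mulrA.
rewrite mulfV -?alphaE // mul1r => /(canRL (subrK _)) ->.
by rewrite subrK.
Qed.
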